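(* Let $(\Omega,\Pi,t)$ be a single player information structure and let $p \in \Delta(\Omega)$ be an arbitrary probability distribution. Then exactly one of the following holds: (1) $p$ is $(\Pi,t)$-disintegrable; (2) $p$ is a money pump.
   Context: $\Omega$ is a finite nonempty set and $\Delta(\Omega)$ is the set of probability measures on $\Omega$ (all subsets measurable). A single player information structure is a tuple $(\Omega,\Pi,t)$ where $\Pi$ is a partition of $\Omega$ and $t\colon\Omega\to\Delta(\Omega)$ is a function such that $t(\omega)(\pi(\omega))=1$ for every $\omega\in\Omega$, where $\pi(\omega)$ is the element of $\Pi$ containing $\omega$, and $t$ is constant on each element of $\Pi$. A distribution $p\in\Delta(\Omega)$ is $(\Pi,t)$-disintegrable if $p(E\cap\pi)=t(\omega)(E)\,p(\pi)$ for every $E\subseteq\Omega$, every $\pi\in\Pi$ and all $\omega\in\pi$. A semi-trade is a function $f\colon\Omega\to\mathbb{R}$ with $\int f\,\mathrm{d}t(\omega)\ge 0$ for all $\omega\in\Omega$. A distribution $p\in\Delta(\Omega)$ is a money pump if there exists a semi-trade $f$ with $\int f\,\mathrm{d}p<0$. *)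

(* Defs.v *)
From HB Require Import structures.
From mathcomp Require Import all_boot all_order all_algebra.
From mathcomp Require Import all_classical all_reals all_analysis.

Set Implicit Arguments.
Unset Strict Implicit.
Unset Printing Implicit Defensive.

Local Open Scope classical_set_scope.
Local Open Scope ereal_scope.

(* Elements of [probability Omega R] are measures on a measurableType, so the
   finite set Omega with all subsets measurable is modelled by a measurableType
   satisfying [discrete_finite]. The definitions below are meant for such Omega:
   every f : Omega -> R is then measurable and integrable. *)
Definition discrete_finite (d : measure_display) (Omega : measurableType d) :=
  [/\ [set: Omega] !=set0, finite_set [set: Omega] &
      forall A : set Omega, measurable A].

(* [pblock Pi id omega] is the element of Pi containing omega. *)
Record info_structure (d : measure_display) (Omega : measurableType d)
    (R : realType) := InfoStructure {
  info_part : set (set Omega);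
  belief : Omega -> probability Omega R;
  info_partP : partition info_part id [set: Omega];
  belief_pblock : forall omega : Omega,
    belief omega (pblock info_part id omega) = 1;
  belief_const : forall B : set Omega, info_part B ->
    forall omega omega' : Omega, B omega -> B omega' ->
      belief omega = belief omega'
}.

Section InfoStructureTheory.
Context (d : measure_display) (Omega : measurableType d) (R : realType).
Variable S : info_structure Omega R.

Definition disintegrable (p : probability Omega R) : Prop :=
  forall (E B : set Omega), info_part S B ->
    forall omega : Omega, B omega -> p (E `&` B) = belief S omega E * p B.

Definition semi_trade (f : Omega -> R) : Prop :=
  forall omega : Omega, 0 <= \int[belief S omega]_x (f x)%:E.

Definition money_pump (p : probability Omega R) : Prop :=
  exists f : Omega -> R, semi_trade f /\ \int[p]_x (f x)%:E < 0.

End InfoStructureTheory.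

(* Main.v *)
(** If [p] violates the disintegration identity at [E] and [B], then
    [p (E `&` B) - c * p B] is nonzero, where [c] is the probability of [E]
    under the belief held on [B]. A multiple of
    [\1_(E `&` B) - c \1_B], a bet on [E] called off outside [B], has zero
    expectation under every belief, and expectation of the chosen sign under
    [p]. Conversely, disintegrability makes [p] the [p]-mixture of the beliefs,
    so no semi-trade can lose on average. *)
Require Import Defs.
From mathcomp Require Import all_boot all_order all_algebra.
From mathcomp Require Import all_classical all_reals all_analysis.
Import Order.TTheory GRing.Theory Num.Theory.

Set Implicit Arguments.
Unset Strict Implicit.
Unset Printing Implicit Defensive.

Local Open Scope classical_set_scope.
Local Open Scope ereal_scope.

Lemma integral_called_off_bet (d : measure_display) (T : measurableType d)
    (R : realType) (mu : probability T R) (A B : set T) (k c : R) :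
  measurable A -> measurable B ->
  \int[mu]_x (k * (\1_A x - c * \1_B x))%R%:E
    = (k * (fine (mu A) - c * fine (mu B)))%R%:E.
Proof.
move=> mA mB.
have iA : mu.-integrable setT (EFin \o (\1_A)%R) by exact: integrable_indic.
have iB : mu.-integrable setT (EFin \o (\1_B)%R) by exact: integrable_indic.
have icB : mu.-integrable setT (fun x => c%:E * (\1_B x)%R%:E).
  exact: (integrableZl measurableT _ iB).
under eq_integral do rewrite EFinM EFinB EFinM.
rewrite integralZl//; last exact: integrableB.
rewrite integralB// integralZl// !integral_indic// !setIT.
by rewrite EFinM EFinB EFinM !fineK// fin_num_measure.
Qed.

(** Over a finite space [f] is a finite combination of indicators of points, so linearity reduces
    the integral to the masses of the points. *)
Lemma integral_finite_sum (d : measure_display) (T : measurableType d)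
    (R : realType) (mu : probability T R) (s : seq T) (f : T -> R) :
  uniq s -> [set: T] = [set` s] -> (forall x, measurable [set x : T]) ->
  \int[mu]_x (f x)%:E = (\sum_(x <- s) f x * fine (mu [set x]))%R%:E.
Proof.
move=> us Ts m1.
have i1 y : mu.-integrable setT (EFin \o (\1_[set y])%R).
  exact: integrable_indic.
transitivity (\int[mu]_x \sum_(y <- s) (f y)%:E * (\1_[set y] x)%R%:E).
  apply: eq_integral => x _.
  have xs : x \in s by have : [set: T] x by []; rewrite Ts.
  (* As [s] has no repetition, [x] occurs once in it, and every other term vanishes at [x]. *)
  rewrite (big_rem x)//= big_seq big1 ?indicE ?mem_set ?mule1 ?adde0//.
  move=> y; rewrite mem_rem_uniq// inE => /andP[yx _].
  rewrite indicE memNset ?mule0// => /= xy.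
  by rewrite xy eqxx in yx.
rewrite integral_sum//; last by move=> y; exact: (integrableZl measurableT _ (i1 y)).
rewrite -sumEFin; apply: eq_bigr => y _.
rewrite integralZl//; last exact: i1.
rewrite integral_indic// setIT.
by rewrite EFinM fineK// fin_num_measure.
Qed.

Lemma measure_finite_sum (d : measure_display) (T : measurableType d)
    (R : realType) (mu : probability T R) (s : seq T) (A : set T) :
  uniq s -> [set: T] = [set` s] -> (forall B : set T, measurable B) ->
  fine (mu A) = (\sum_(x <- s) \1_A x * fine (mu [set x]))%R.
Proof.
move=> us Ts mT; apply: EFin_inj.
rewrite -(integral_finite_sum mu (\1_A)%R us Ts)//.
by rewrite integral_indic// setIT fineK// fin_num_measure.
Qed.

Section beliefs.
Context (d : measure_display) (Omega : measurableType d) (R : realType).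
Variable S : info_structure Omega R.
Hypothesis mT : forall A : set Omega, measurable A.

Lemma info_part_pblock (x : Omega) :
  info_part S (pblock (info_part S) id x) /\ pblock (info_part S) id x x.
Proof.
have [cov _ _] := info_partP S.
have [B SB Bx] : cover (info_part S) id x by rewrite cov.
(* [pblock] picks its block by choice, so the existence of one block containing [x] suffices. *)
exact: (@getPex _ [set i | info_part S i /\ i x]) (ex_intro _ B (conj SB Bx)).
Qed.

Lemma pblock_info_part (B : set Omega) (x : Omega) :
  info_part S B -> B x -> pblock (info_part S) id x = B.
Proof.
move=> SB Bx; have [_ triv _] := info_partP S.
have [SB' B'x] := info_part_pblock x.
by apply: triv => //; exists x.
Qed.

Lemma belief_info_part (B : set Omega) (x : Omega) :
  info_part S B -> B x -> belief S x B = 1.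
Proof. by move=> SB Bx; rewrite -(belief_pblock S x) (pblock_info_part SB). Qed.

(** The belief at [x] is concentrated on the block of [x], which is disjoint from [B]. *)
Lemma belief_info_partC (B E : set Omega) (x : Omega) :
  info_part S B -> ~ B x -> belief S x (E `&` B) = 0.
Proof.
move=> SB nBx; have [SB' B'x] := info_part_pblock x.
have bC : belief S x (~` pblock (info_part S) id x) = 0.
  by rewrite probability_setC// belief_pblock subee.
apply: (subset_measure0 _ _ _ bC) => // y [_ By] B'y.
by apply: nBx; rewrite -(pblock_info_part SB By) (pblock_info_part SB' B'y).
Qed.

Lemma belief_setI_info_part (B E : set Omega) (x : Omega) :
  info_part S B -> B x -> belief S x (E `&` B) = belief S x E.
Proof.
move=> SB Bx.
have BC : belief S x (~` B) = 0.
  by rewrite probability_setC// belief_info_part// subee.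
have EBC : belief S x (E `\` B) = 0.
  by apply: (subset_measure0 _ _ _ BC) => // y [].
have -> : belief S x E = belief S x (E `\` B) + belief S x (E `&` B).
  exact: measureDI.
by rewrite EBC add0e.
Qed.

Lemma money_pump_of_not_disintegrable (p : probability Omega R) :
  ~ disintegrable S p -> money_pump S p.
Proof.
move=> /existsNP[E] /existsNP[B] /not_implyP[SB] /existsNP[w] /not_implyP[Bw].
move=> pEB.
pose c := fine (belief S w E).
pose k := (fine (p (E `&` B)) - c * fine (p B))%R.
have k0 : k != 0%R.
  apply/eqP => /subr0_eq kE; apply: pEB.
  rewrite -[LHS]fineK ?fin_num_measure// kE EFinM.
  by rewrite !fineK ?fin_num_measure.
(* The factor [- k] turns the expectation under [p] into [- k ^ 2], negative whatever the sign of
   [k]. *)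
exists (fun x => - k * (\1_(E `&` B) x - c * \1_B x))%R; split.
  move=> x; rewrite integral_called_off_bet//.
  (* On [B] the belief gives [E] mass [c] and [B] mass 1; off [B] the bet is almost surely called
     off. Both expectations are 0. *)
  have [Bx|nBx] := pselect (B x).
    rewrite (belief_setI_info_part E SB Bx) (belief_info_part SB Bx).
    by rewrite (belief_const SB Bx Bw) /= mulr1 subrr mulr0.
  have := belief_info_partC setT SB nBx; rewrite setTI => ->.
  by rewrite belief_info_partC//= mulr0 subrr mulr0.
rewrite integral_called_off_bet// lte_fin mulNr oppr_lt0.
by rewrite -expr2 exprn_even_gt0.
Qed.

(** Apply disintegrability to the event [[set x]] and the block [B] of [x], then split [p B] over
    the points of [B]. They share the belief of [x], while beliefs held outside [B] give [x] mass
    0. *)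
Lemma disintegrable_mixture (p : probability Omega R) (s : seq Omega)
    (x : Omega) :
  uniq s -> [set: Omega] = [set` s] -> disintegrable S p ->
  fine (p [set x])
    = (\sum_(y <- s) fine (p [set y]) * fine (belief S y [set x]))%R.
Proof.
move=> us Ts dp; have [SB Bx] := info_part_pblock x.
set B := pblock _ _ _ in SB Bx.
have xB : [set x] `&` B = [set x] by apply: setIidl => _ ->.
rewrite -[in LHS]xB (dp _ _ SB _ Bx) fineM ?fin_num_measure//.
rewrite (measure_finite_sum p B us Ts)// mulr_sumr; apply: eq_bigr => y _.
have [By|nBy] := pselect (B y).
  by rewrite indicE mem_set// mul1r mulrC (belief_const SB By Bx).
rewrite indicE memNset// mul0r mulr0.
by rewrite -xB belief_info_partC//= mulr0.
Qed.

Lemma disintegrable_not_money_pump (p : probability Omega R) :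
  finite_set [set: Omega] -> disintegrable S p -> ~ money_pump S p.
Proof.
move=> /finite_seqP[r Tr] dp [f [fS]].
pose s := undup r.
have us : uniq s by exact: undup_uniq.
have Ts : [set: Omega] = [set` s].
  by rewrite Tr; apply/seteqP; split=> x /=; rewrite mem_undup.
rewrite (integral_finite_sum p f us Ts)// lte_fin ltNge => /negP; apply.
(* Exchanging the two sums leaves the average, with weights [p [set y]], of the expectations of [f]
   under the beliefs at [y], each nonnegative because [f] is a semi-trade. *)
under eq_bigr do rewrite (disintegrable_mixture _ us Ts dp) mulr_sumr.
rewrite exchange_big/=; apply: sumr_ge0 => y _.
under eq_bigr do rewrite mulrCA.
rewrite -mulr_sumr mulr_ge0 ?fine_ge0//.
by rewrite -lee_fin -(integral_finite_sum (belief S y) f us Ts).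
Qed.

End beliefs.

Theorem theorem11 (R : realType) (d : measure_display)
    (Omega : measurableType d) (Omega_fin : discrete_finite Omega)
    (S : info_structure Omega R) (p : probability Omega R) :
  (disintegrable S p \/ money_pump S p) /\
  ~ (disintegrable S p /\ money_pump S p).
Proof.
have [_ fT mT] := Omega_fin.
split.
  have [dp|ndp] := pselect (disintegrable S p); first by left.
  by right; exact: money_pump_of_not_disintegrable.
by move=> [dp mp]; exact: (disintegrable_not_money_pump mT fT dp mp).
Qed.
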